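(* Let $X$ be an equivalence-relational join space. The following conditions are equivalent: (1) $X$ is join-equivalence-relational. (2) $X$ is join-transitive. (3) For all $a,b,c\in X$, $a(bc)\subseteq(ab)c$. (4) For all $a,b,c,d\in X$, if $(c,b,a,d)$ is dependent, then $(a,b,c,d)$ is dependent. (5) $X$ is preprojective.
   Context: A join space is a set $X$ with a ternary relation $\langle\cdot,\cdot,\cdot\rangle$ on $X$ (a join relation) such that: $\langle a,x,x\rangle$ for all $a,x\in X$; $\langle x,b,y\rangle$ implies $\langle y,b,x\rangle$ for all $x,b,y\in X$; and $\langle x,y,x\rangle$ implies $y=x$ for all $x,y\in X$. For $a,c\in X$ put $ac:=\{x\in X\mid\langle a,x,c\rangle\}$. For subsets $A,B,C\subseteq X$, $\langle A,B,C\rangle$ means that there are $a\in A$, $b\in B$, $c\in C$ with $\langle a,b,c\rangle$, and $AC:=\{x\in X\mid \langle A,\{x\},C\rangle\}$, the union of all $ac$ with $a\in A$, $c\in C$. Singletons $\{x\}$ are written $x$ in these notations; e.g. $a(bc)$ is the join of $\{a\}$ with the set $bc$. For $A\subseteq X$: $X$ is $A$-transitive iff the binary relation $\langle A,\cdot,\cdot\rangle$ is transitive on $X$ (equivalently, for all $b,c\in X$, $\langle A,b,c\rangle$ implies $Ab\subseteq Ac$). $X$ is $A$-symmetric iff the binary relation $\langle A,\cdot,\cdot\rangle$ is symmetric on $X\setminus A$. $X$ is $A$-equivalence-relational iff it is $A$-transitive and $A$-symmetric. $X$ is transitive (resp. symmetric, equivalence-relational) iff it is $\{a\}$-transitive (resp.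 $\{a\}$-symmetric, $\{a\}$-equivalence-relational) for every $a\in X$. $X$ is join-transitive iff for all $a,b\in X$ it is $ab$-transitive. $X$ is join-equivalence-relational iff for all $a,b\in X$ it is $ab$-equivalence-relational (equivalently: $X$ is join-transitive and symmetric). A quadruple $(a,b,c,d)$ of elements of $X$ is dependent iff $b=a$ or $c\in ab$ or $d\in(ab)c$. $X$ is preprojective iff it is equivalence-relational and for all $a,b,c,d\in X$: if $b=c$ or $a=d$ or $bc\cap ad\neq\emptyset$, then $a=b$ or $c=d$ or $ab\cap cd\neq\emptyset$. *)

(* Defs.v *)
From mathcomp Require Import all_boot.
From mathcomp Require Import boolp classical_sets.

Set Implicit Arguments.
Unset Strict Implicit.
Unset Printing Implicit Defensive.

Local Open Scope classical_set_scope.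

Record joinSpace := JoinSpace {
  carrier :> Type;
  join_rel : carrier -> carrier -> carrier -> Prop;
  join_rel_refl : forall a x, join_rel a x x;
  join_rel_sym : forall x b y, join_rel x b y -> join_rel y b x;
  join_rel_anti : forall x y, join_rel x y x -> y = x
}.

(* ac *)
Definition join (X : joinSpace) (a c : X) : set X := [set x | join_rel a x c].

(* <A, B, C> *)
Definition join_relS (X : joinSpace) (A B C : set X) : Prop :=
  exists a b c, [/\ A a, B b, C c & join_rel a b c].

(* AC *)
Definition joinS (X : joinSpace) (A C : set X) : set X :=
  [set x | join_relS A [set x] C].

Definition set_transitive (X : joinSpace) (A : set X) : Prop :=
  forall x y z : X, join_relS A [set x] [set y] ->
    join_relS A [set y] [set z] -> join_relS A [set x] [set z].

Definition set_symmetric (X : joinSpace) (A : set X) : Prop :=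
  forall x y : X, ~ A x -> ~ A y ->
    join_relS A [set x] [set y] -> join_relS A [set y] [set x].

Definition set_equivalence_relational (X : joinSpace) (A : set X) : Prop :=
  set_transitive A /\ set_symmetric A.

Definition equivalence_relational (X : joinSpace) : Prop :=
  forall a : X, set_equivalence_relational [set a].

Definition join_transitive (X : joinSpace) : Prop :=
  forall a b : X, set_transitive (join a b).

Definition join_equivalence_relational (X : joinSpace) : Prop :=
  forall a b : X, set_equivalence_relational (join a b).

Definition dependent (X : joinSpace) (a b c d : X) : Prop :=
  [\/ b = a, join a b c | joinS (join a b) [set c] d].

Definition preprojective (X : joinSpace) : Prop :=
  equivalence_relational X /\
  forall a b c d : X,
    [\/ b = c, a = d | (join b c `&` join a d) !=set0] ->
    [\/ a = b, c = d | (join a b `&` join c d) !=set0].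

(* Main.v *)
Require Import Defs.
From mathcomp Require Import all_boot.
From mathcomp Require Import boolp classical_sets.

Local Open Scope classical_set_scope.

(** In an equivalence-relational join space the sets [ab] with [a <> b] are the
    lines of a linear space: any two distinct points of a line span it. In these
    terms [a(bc) `<=` (ab)c] says that if [y] lies on [bc] and [x] on [ay], then
    the lines [ab] and [cx] meet. This is the Veblen-Young axiom
    (preprojectivity), and also the exchange of the first and third entry of a
    dependent quadruple; since lines are convex, it moreover yields transitivity
    of [<ab, ., .>]. *)

Lemma join_relS1 (X : joinSpace) (A : set X) (x y : X) :
  join_relS A [set x] [set y] <-> exists2 p, A p & join_rel p x y.
Proof.
split=> [[p [_ [_ [Ap -> -> pxy]]]]|[p Ap pxy]]; first by exists p.
by exists p, x, y.
Qed.

Lemma joinS1r (X : joinSpace) (A : set X) (c x : X) :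
  joinS A [set c] x <-> exists2 p, A p & join_rel p x c.
Proof. exact: join_relS1. Qed.

Lemma joinS1l (X : joinSpace) (a : X) (B : set X) (x : X) :
  joinS [set a] B x <-> exists2 y, B y & join_rel a x y.
Proof.
split=> [[_ [_ [y [-> -> By axy]]]]|[y By axy]]; first by exists y.
by exists a, x, y.
Qed.

Lemma join_rell {X : joinSpace} (a x : X) : join_rel a a x.
Proof. exact/join_rel_sym/join_rel_refl. Qed.

Section EquivalenceRelational.
Set Implicit Arguments.
Unset Strict Implicit.
Variables (X : joinSpace) (hX : equivalence_relational X).
Implicit Types a b c d p q r x y z : X.

Lemma join_rel_trans a x y z :
  join_rel a x y -> join_rel a y z -> join_rel a x z.
Proof.
move=> axy ayz; have [trans_a _] := hX a.
have /join_relS1[_ -> //] : join_relS [set a] [set x] [set z].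
by apply: (trans_a x y z); apply/join_relS1; exists a.
Qed.

(* Only [x <> a] is needed, because [<a, x, a>] forces [x = a]. *)
Lemma join_rel_exchange a x y : x <> a -> join_rel a x y -> join_rel a y x.
Proof.
move=> xa axy; have [_ sym_a] := hX a.
have ya : y <> a by move=> ya; apply/xa/join_rel_anti; rewrite -{2}ya.
have /join_relS1[_ -> //] : join_relS [set a] [set y] [set x].
by apply: sym_a => //; apply/join_relS1; exists a.
Qed.

(** If [p <> a], exchange at [a] puts [q] on [ap]; transitivity at [p] then puts [r] on [ap], and
    transitivity at [a] carries it to [ab]. *)
Lemma join_convex a b p q r :
  join a b p -> join a b q -> join p q r -> join a b r.
Proof.
rewrite /join /= => apb aqb prq; have [pa|pa] := pselect (p = a).
  by rewrite pa in prq; exact: join_rel_trans prq aqb.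
have aqp : join_rel a q p.
  exact: join_rel_trans aqb (join_rel_exchange pa apb).
apply: join_rel_trans apb; apply: join_rel_sym.
exact: join_rel_trans prq (join_rel_sym aqp).
Qed.

Definition join_semiassoc :=
  forall a b c, joinS [set a] (join b c) `<=` joinS (join a b) [set c].

(** Both [a] and [b] belong to [ab], so they witness the two links from [x] to [y] and from [y] to
    [c]. *)
Lemma join_transitive_semiassoc : join_transitive X -> join_semiassoc.
Proof.
move=> trans_ab a b c x /joinS1l[y byc axy]; apply: (trans_ab a b x y c).
  by apply/join_relS1; exists a => //; exact: join_rell.
by apply/join_relS1; exists b => //; exact: join_rel_refl.
Qed.

Lemma semiassoc_dependent :
  join_semiassoc -> forall a b c d, dependent c b a d -> dependent a b c d.
Proof.
move=> assoc a b c d [-> | cab | /joinS1r[p cpb pda]].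
- by apply: Or32; exact: join_rel_refl.
- have [->|ab] := pselect (a = b); first exact: Or31.
  by apply/Or32/join_rel_sym/join_rel_exchange/join_rel_sym.
(* Reversing both joins turns [d] in [(cb)a] into [d] in [a(bc)]. *)
- apply/Or33/assoc/joinS1l; exists p; exact: join_rel_sym.
Qed.

Lemma dependent_preprojective :
  (forall a b c d, dependent c b a d -> dependent a b c d) ->
  preprojective X.
Proof.
move=> dep; split=> // a b c d [-> | -> | [p [bpc apd]]].
- by apply: Or33; exists c; split; [exact: join_rel_refl | exact: join_rell].
- by apply: Or33; exists d; split; [exact: join_rell | exact: join_rel_refl].
have [ab|ab] := pselect (a = b); first exact: Or31.
have [cd|cd] := pselect (c = d); first exact: Or32.
have abc_meet : join a b c -> (join a b `&` join c d) !=set0.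
  by move=> abc; exists c; split=> //; exact: join_rell.
(* If [p = a], then [a] is on [bc], and exchange at [b] puts [c] on [ab]. Otherwise exchange at [a]
   puts [d] on [ap], which makes [(c,b,a,d)] dependent. *)
apply: Or33; have [pa|pa] := pselect (p = a).
  by apply/abc_meet/join_rel_sym/join_rel_exchange => //; rewrite -pa.
have /dep[ba| |/joinS1r[q abq qdc]] : dependent c b a d.
- apply/Or33/joinS1r; exists p; first exact: join_rel_sym.
  exact/join_rel_sym/join_rel_exchange.
- by case: ab.
- exact: abc_meet.
(* Since [d <> c], exchange at [c] turns [d] on [cq] into [q] on [cd]. *)
- exists q; split=> //; apply: join_rel_exchange; last exact: join_rel_sym.
  by move=> dc; apply: cd.
Qed.

Lemma preprojective_semiassoc : preprojective X -> join_semiassoc.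
Proof.
move=> [_ veblen] a b c x /joinS1l[y byc axy]; apply/joinS1r.
have [->|xa] := pselect (x = a).
  by exists a; [exact: join_rell | exact: join_rell].
have ayx : join_rel a y x by exact: join_rel_exchange.
have [|ab|cx|[q [abq cqx]]] := veblen a b c x.
- by apply: Or33; exists y.
- rewrite -ab in byc *; exists a; first exact: join_rell.
  exact: join_rel_trans axy byc.
- by rewrite cx; exists a; [exact: join_rell | exact: join_rel_refl].
(* For [q <> c], exchange at [c] puts [x] on [cq]. For [q = c], the point [c], hence [y], hence [x]
   lies on [ab], and [x] itself is the witness. *)
have [qc|qc] := pselect (q = c).
  rewrite qc in abq; exists x; last exact: join_rell.
  apply: join_convex (join_rell _ _) _ axy.
  exact: join_convex (join_rel_refl _ _) abq byc.
by exists q => //; exact/join_rel_sym/join_rel_exchange.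
Qed.

(** For transitivity, [x] in [p(qz)] moves to [(pq)z], and convexity keeps [pq] inside [ab].
    Symmetry is exchange at [p], as [x] outside [ab] differs from [p]. *)
Lemma semiassoc_join_equivalence_relational :
  join_semiassoc -> join_equivalence_relational X.
Proof.
move=> assoc a b; split=> [x y z|x y abx aby] /join_relS1[p abp pxy].
  move=> /join_relS1[q abq qyz].
  have /joinS1r[r pqr rxz] : joinS (join p q) [set z] x.
    by apply/assoc/joinS1l; exists y.
  by apply/join_relS1; exists r => //; exact: join_convex abp abq pqr.
apply/join_relS1; exists p => //; apply: join_rel_exchange => // xp.
by apply: abx; rewrite xp.
Qed.

End EquivalenceRelational.

Theorem theorem5p2 (X : joinSpace) (hX : equivalence_relational X) :
  [<-> join_equivalence_relational X;
       join_transitive X;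
       forall a b c : X,
         joinS [set a] (join b c) `<=` joinS (join a b) [set c];
       forall a b c d : X, dependent c b a d -> dependent a b c d;
       preprojective X].
Proof.
tfae.
- by move=> er a b; have [] := er a b.
- exact: join_transitive_semiassoc.
- exact: semiassoc_dependent.
- exact: dependent_preprojective.
- by move=> /(preprojective_semiassoc hX)
    /(semiassoc_join_equivalence_relational hX).
Qed.
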